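(* For all integers $k\ge1$ and all $\alpha\in[1/2,1]$, the $k$-Brjuno function $B_{k,\alpha}$ is a $\mathrm{BMO}$ function (i.e. belongs to $\mathrm{BMO}(\mathbb{R})$).
   Context: For $\alpha\in[1/2,1]$ let $A_\alpha:(0,\alpha)\to[0,\alpha]$, $A_\alpha(x)=\left|\frac1x-\left\lfloor\frac1x-\alpha+1\right\rfloor\right|$. For irrational $x\in(0,\alpha)$ put $\beta^{(\alpha)}_{-1}(x)=1$, $\beta^{(\alpha)}_j(x)=\prod_{i=0}^jA_\alpha^i(x)$ for $j\ge0$, and $$B_{k,\alpha}(x)=\sum_{n=0}^\infty\left(\beta^{(\alpha)}_{n-1}(x)\right)^k\log\left(\frac1{A_\alpha^n(x)}\right).$$ $B_{k,\alpha}$ is extended to (almost all of) $\mathbb{R}$ by requiring it to be $\mathbb{Z}$-periodic and to satisfy $f(-x)=f(x)$ for a.e. $x\in(0,1-\alpha)$. For an interval $U$ a locally integrable $f$ is in $\mathrm{BMO}(U)$ if $\sup_{I\subset U}\frac1{|I|}\int_I|f(x)-f_I|\,dx<\infty$, where the supremum is over bounded intervals $I$ and $f_I=\frac1{|I|}\int_If(x)\,dx$. *)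

(* Defs.v *)
From HB Require Import structures.
From mathcomp Require Import all_boot all_order all_algebra.
From mathcomp Require Import all_classical all_reals all_analysis.
From mathcomp Require Import ring lra.

Set Implicit Arguments.
Unset Strict Implicit.
Unset Printing Implicit Defensive.

Import Order.TTheory GRing.Theory Num.Theory.
Import numFieldNormedType.Exports.

Local Open Scope classical_set_scope.
Local Open Scope ring_scope.

Definition cfmap (R : realType) (alpha x : R) : R :=
  `| x^-1 - (Num.floor (x^-1 - alpha + 1))%:~R |.

(* The index is shifted by one: [cfbeta alpha n x] is the usual beta_{n-1}(x),
   so that [cfbeta alpha 0 x = 1] is beta_{-1}(x). *)
Definition cfbeta (R : realType) (alpha : R) (n : nat) (x : R) : R :=
  \prod_(i < n) iter i (cfmap alpha) x.

(* The sum is taken in the extended reals since the series diverges to +oo at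
   some irrational points. *)
Definition brjuno_series (R : realType) (k : nat) (alpha x : R) : \bar R :=
  (\sum_(0 <= n <oo)
     (cfbeta alpha n x ^+ k * ln ((iter n (cfmap alpha) x)^-1))%:E)%E.

(* [F] is a representative of the k-Brjuno function B_{k,alpha}, which is only
   determined almost everywhere. *)
Definition is_brjuno (R : realType) (k : nat) (alpha : R) (F : R -> \bar R) :
    Prop :=
  [/\ forall x : R, irrational x -> 0 < x < alpha ->
        F x = brjuno_series k alpha x,
      forall m : int,
        {ae @lebesgue_measure R, forall x : R, F (x + m%:~R) = F x} &
      {ae @lebesgue_measure R, forall x : R,
        0 < x < 1 - alpha -> F (- x) = F x}].

Definition mean (R : realType) (f : R -> R) (I : set R) : R :=
  (fine (lebesgue_measure I))^-1 * \int[lebesgue_measure]_(x in I) f x.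

(* Mean oscillation over bounded subintervals; [iavg g I] is the average of
   |g| over I. *)
Definition has_BMO (R : realType) (U : set R) (f : R -> R) : Prop :=
  locally_integrable U f /\
  (ereal_sup [set iavg (fun x => f x - mean f I)%R I | I in
     [set I : set R | [/\ I `<=` U, is_interval I, bounded_set I &
                          (0 < lebesgue_measure I)%E]]] < +oo)%E.

(* Membership of an a.e. defined, possibly infinite, function F: it must be
   a.e. finite on U.  As [measurable] means Borel on the real line, passing to
   an a.e. equal f is also what allows F to be merely Lebesgue measurable. *)
Definition BMO (R : realType) (U : set R) (F : R -> \bar R) : Prop :=
  exists f : R -> R,
    {ae @lebesgue_measure R, forall x : R, U x -> F x = (f x)%:E} /\
    has_BMO U f.

(* The requirements in [is_brjuno] can be met: fold x to |x - m|, where m is the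
   integer such that x - m lies in [alpha - 1, alpha). *)
Lemma is_brjuno_exists (R : realType) (k : nat) (alpha : R) :
  2^-1 <= alpha <= 1 -> exists F : R -> \bar R, is_brjuno k alpha F.
Proof.
move=> /andP[a2 a1].
have f0 (y : R) : alpha - 1 <= y < alpha -> Num.floor (y - alpha + 1) = 0.
  move=> /andP[y0 y1]; apply: floor_def.
  by rewrite add0r mulr0z mulr1z; apply/andP; split; lra.
exists (fun x => brjuno_series k alpha
  `|x - (Num.floor (x - alpha + 1))%:~R|); split.
- move=> x _ /andP[x0 xa].
  by rewrite f0 ?subr0 ?gtr0_norm //; apply/andP; split; lra.
- move=> m; apply: aeW => x /=; congr (brjuno_series _ _ `|_|).
  have -> : x + m%:~R - alpha + 1 = (x - alpha + 1) + m%:~R by ring.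
  by rewrite floorDrz ?intr_int // intrKfloor intrD; ring.
- apply: aeW => x /= /andP[x0 xa].
  by rewrite !f0 ?subr0 ?normrN //; apply/andP; split; lra.
Qed.

(* Main.v *)
Require Import Defs.
From HB Require Import structures.
From mathcomp Require Import all_boot all_order all_algebra.
From mathcomp Require Import all_classical all_reals all_analysis.
From mathcomp Require Import measurable_realfun.
From mathcomp Require Import ring lra zify.

(** The k-Brjuno function is, up to a bounded error, a superposition of
    logarithmic bumps centred at all the rationals, and such a superposition
    is in BMO as soon as the supports of the bumps do not overlap too much.

    Let x be irrational, with convergents p_n/q_n given by its alpha-continued
    fraction.  Then q_n beta_{n-1} lies in [1/2, 2] and differs from 1 by at
    most 2 x_n, where x_n is the n-th iterate, while
    |x - p_n/q_n| = beta_{n-1} x_n / q_n.  So the n-th term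
    beta_{n-1}^k log(1/x_n) of the Brjuno series equals
    q_n^{-k} log^+ (1 / (8 q_n^2 |x - p_n/q_n|)) up to O(1/q_n)
    ([brjuno_term_close]), and the errors add up to a bounded amount since
    beta_{n+1} <= beta_{n-1}/2 ([sum_cfbeta_le]).  Conversely, a Legendre type
    criterion ([good_approx_convergent]) shows that every reduced fraction
    p/q with q^2 |x - p/q| <= 1/8 is a convergent of x.  Hence the Brjuno
    series differs by a bounded amount from the sum over all rationals p/q of
    the bumps q^{-k} log^+ (s / |x - p/q|), where s = 1/(8 q^2)
    ([brjuno_near_rat_log_bumps]).

    Consider a single bump w log^+ (s / |x - r|), supported in the segment J
    of radius s around r.  Over a segment I it stays within 4 w |I /\ J| in L^1
    norm of a suitable constant ([integral_log_bump_osc]); the bound involves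
    the length of I /\ J, and not that of I, because the constant may be taken
    to be 0 when I leaves J.  Summing over all bumps, the oscillation of the
    superposition over I is at most 4 times the integral over I of the function
    sum of w 1_J.  At an irrational x that function only sees convergents of x,
    so it is at most the sum of the q_n^{-k}, which is at most 8
    ([rat_bumps_overlap]).  This is the BMO bound ([near_log_bump_BMO]).

    The Z-periodicity and the evenness on (0, 1 - alpha) say that a.e. the
    value at x is the Brjuno series at the distance from x to the integer m
    such that x - m lies in [alpha - 1, alpha) ([is_brjuno_folded]); the
    comparison with bumps applies directly on the whole line, by starting the
    continued fraction expansion of x with the integer m. *)

Set Implicit Arguments.
Unset Strict Implicit.
Unset Printing Implicit Defensive.

Import Order.TTheory GRing.Theory Num.Theory.
Import numFieldNormedType.Exports.

Local Open Scope classical_set_scope.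
Local Open Scope ring_scope.

(** * Series of nonnegative terms *)

Section nonneg_series.
Variable R : realType.
Implicit Types u v : nat -> \bar R.
Local Open Scope ereal_scope.

Lemma nneseries_le u (C : \bar R) : (forall i, 0 <= u i) ->
  (forall n, \sum_(i < n) u i <= C) -> \sum_(0 <= i <oo) u i <= C.
Proof.
move=> u0 uC; apply: lime_le; first by apply: is_cvg_nneseries => i _ _; exact: u0.
by apply: nearW => n; rewrite big_mkord.
Qed.

Lemma nneseries_half_pow : \sum_(0 <= j <oo) ((2^-1 : R) ^+ j)%:E <= 2%:E.
Proof.
apply: nneseries_le => [i|n]; first by rewrite lee_fin exprn_ge0.
rewrite sumEFin lee_fin.
suff : (\sum_(i < n) 2^-1 ^+ i + 2 * 2^-1 ^+ n <= (2 : R))%R.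
  by have : (0 <= (2^-1 : R) ^+ n)%R by []; lra.
elim: n => [|n IHn]; first by rewrite big_ord0 expr0; lra.
by rewrite big_ord_recr/= exprS; lra.
Qed.

Lemma count_le_nneseries (P : pred nat) n : (forall j, (j < n)%N -> P j) ->
  (n%:R : R)%:E <= \sum_(0 <= j <oo) ((P j)%:R : R)%:E.
Proof.
move=> Pn; apply: le_trans (nneseries_lim_ge n _) => [|i _ _]; last first.
  by rewrite lee_fin.
rewrite big_mkord sumEFin lee_fin -[n in n%:R]card_ord -sum1_card natr_sum.
by apply: ler_sum => i _; rewrite Pn.
Qed.

Lemma nneseries_reindex (h : nat -> \bar R) (e : nat -> nat) :
  (forall i, (0 <= h i)%E) -> injective e ->
  (forall i, (forall n, i != e n) -> h i = 0%E) ->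
  (\sum_(0 <= i <oo) h i = \sum_(0 <= n <oo) h (e n))%E.
Proof.
move=> h0 inj_e off; rewrite !nneseries_esumT//.
rewrite -(@esum_image _ _ _ setT e h) ?image_id//; last by move=> ? ? _ _ /inj_e.
rewrite [RHS]esum_mkcond; apply: eq_esum => i _.
case: ifPn => // /negP ie; apply: off => n; apply/eqP => in_e.
by apply: ie; rewrite inE; exists n.
Qed.

End nonneg_series.

(** * Oscillation of a logarithmic bump *)

Section log_bump.
Variable R : realType.
Implicit Types (a b r s t M l : R).

Definition lnp (z : R) : R := Num.max 0 (ln z).

Lemma lnp_ge0 z : 0 <= lnp z.
Proof. by rewrite le_max lexx. Qed.

Lemma ln_le_nat t n : 0 < t -> t <= 2 ^+ n -> ln t <= n%:R.
Proof.
move=> t0 tn; apply: (@le_trans _ _ (ln (2 ^+ n))).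
  by rewrite ler_ln ?posrE// exprn_gt0.
rewrite lnXn// -[leLHS]mulr_natl ler_piMr//.
by have := @le_ln1Dx R 1; apply; lra.
Qed.

Lemma dyadic_scale M t : 0 < M -> 0 < t -> t <= M -> exists n,
  ln (M / t) <= n%:R /\ (forall j, (j < n)%N -> t <= M * 2^-1 ^+ j).
Proof.
move=> M0 t0 tM; have Mt0 : 0 < M / t by rewrite divr_gt0.
have [k kP] : exists k, M * 2^-1 ^+ k < t.
  exists (Num.bound (M / t)); rewrite exprVn ltr_pdivrMr ?exprn_gt0// mulrC.
  rewrite -ltr_pdivrMr//; apply: lt_trans (archi_boundP (ltW Mt0)) _.
  by rewrite -natrX ltr_nat ltn_expl.
have : exists k, M * 2^-1 ^+ k < t by exists k.
case/ex_minnP => n nP nmin; exists n; split; last first.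
  by move=> j jn; rewrite leNgt; apply/negP => /nmin; rewrite leqNgt jn.
apply: ln_le_nat => //; rewrite ler_pdivrMr// -ler_pdivrMl ?exprn_gt0//.
by rewrite mulrC -exprVn ltW.
Qed.

(** The oscillation of the bump is controlled by a sum of indicators of
    dyadically shrinking segments, which are easier to integrate than the
    logarithm.  At the centre of the bump, where the value given by [lnp] is
    meaningless, the right-hand side is infinite. *)
Lemma lnp_osc s M t : 0 < M -> M <= s -> 0 <= t -> (M < s -> t <= M) ->
  (`|lnp (s / t) - ln (s / M)|%:E <=
   \sum_(0 <= j <oo) ((t <= M * 2^-1 ^+ j)%R%:R : R)%:E)%E.
Proof.
move=> M0 Ms t0 tM; have s0 : 0 < s by lra.
case: (leP t M) => [{}tM|Mt]; last first.
  have sM : s = M by apply/eqP; rewrite eq_le Ms andbT leNgt; apply/negP => /tM; lra.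
  rewrite /lnp max_l; last by rewrite ln_le0// ler_pdivrMr; lra.
  rewrite sM divff ?gt_eqF// ln1 subrr normr0.
  by apply: nneseries_ge0 => n _ _; rewrite lee_fin.
move: t0; rewrite le_eqVlt => /predU1P[<-|t0].
  set L := `|_|; have L0 : 0 <= L by rewrite normr_ge0.
  apply: le_trans (@count_le_nneseries R _ (Num.bound L) _) => [|j _ /=].
    by rewrite lee_fin ltW// archi_boundP.
  by rewrite mulr_ge0 ?exprn_ge0// ltW.
have [n [Mtn nP]] := dyadic_scale M0 t0 tM.
apply: le_trans (@count_le_nneseries R _ n nP); rewrite lee_fin.
apply: le_trans Mtn; rewrite /lnp max_r; last first.
  by rewrite ln_ge0// ler_pdivlMr; lra.
rewrite !ln_div ?posrE//.
have : ln t <= ln M by rewrite ler_ln.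
by move=> tlM; rewrite ger0_norm; lra.
Qed.

(** Here [A] and [B] are the end points of a segment I relative to the centre of
    the bump, M is the largest distance from that centre reached in the part of
    I inside the support [-s, s], and the lengths compared are those of the parts
    of I inside [-lM, lM] and inside [-s, s].  If I contains the centre, its part
    in the support has length at least M, while [-lM, lM] has length 2lM.  If
    not, replacing the radius M by lM pulls the far end point towards the centre
    while the near one stays put, so the length shrinks by a factor l at least. *)
Lemma shrink_length (A B s l : R) : 0 < s -> 0 <= l <= 1 -> A < B ->
  let M := Num.min s (Num.max `|A| `|B|) in
  Num.max 0 (Num.min B (l * M) - Num.max A (- (l * M))) <=
  2 * l * Num.max 0 (Num.min B s - Num.max A (- s)).
Proof.
move=> s0 /andP[l0 l1] AB; cbv zeta; set M := Num.min s _.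
have M0 : 0 <= M by rewrite /M le_min le_max normr_ge0 (ltW s0).
have Ms : M <= s by rewrite /M ge_min lexx.
have MAB : M <= `|A| \/ M <= `|B|.
  by apply/orP; rewrite -le_max /M ge_min lexx orbT.
have lM : l * M <= M by nra.
have lM0 : 0 <= l * M by nra.
set u := Num.min B (l * M); set v := Num.max A (- (l * M)).
set U := Num.min B s; set V := Num.max A (- s).
have m0 : 0 <= Num.max 0 (U - V) by rewrite le_max lexx.
have mUV : U - V <= Num.max 0 (U - V) by rewrite le_max lexx orbT.
rewrite ge_max; apply/andP; split; first by nra.
case: (leP u v) => uv; first by nra.
have uB : u <= B by rewrite /u ge_min lexx.
have ulM : u <= l * M by rewrite /u ge_min lexx orbT.
have vA : A <= v by rewrite /v le_max lexx.
have vlM : - (l * M) <= v by rewrite /v le_max lexx orbT.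
suff : u - v <= 2 * l * (U - V) by nra.
case: MAB; [case: (ler0P A) => A0 MA | case: (ger0P B) => B0 MB]; last by lra.
- have VM : V <= - M by rewrite /V ge_max; apply/andP; split; lra.
  case: (leP 0 B) => B0.
    have U0 : 0 <= U by rewrite /U le_min B0 ltW.
    by nra.
  have UB : B <= U by rewrite /U le_min lexx; lra.
  have : u - v <= l * (B + M) by nra.
  by nra.
- by lra.
- have UM : M <= U by rewrite /U le_min MB Ms.
  case: (leP A 0) => A0.
    have V0 : V <= 0 by rewrite /V ge_max A0; lra.
    by nra.
  have VA : V <= A by rewrite /V ge_max lexx; lra.
  have : u - v <= l * (M - A) by nra.
  by nra.
Qed.

End log_bump.

Section log_bump_integral.
Variable R : realType.
Implicit Types (a b r s t M l w x : R).
Local Notation mu := (@lebesgue_measure R).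

Definition bump_itv r s : set R := `[r - s, r + s]%classic.

Definition log_bump w r s x : R := w * lnp (s / `|x - r|).

(** The largest distance to [r] within the part of the segment between [a] and
    [b] that lies in the support of the bump, when that part is nonempty. *)
Definition bump_reach a b r s : R := Num.min s (Num.max `|a - r| `|b - r|).

(** The infimum, off the centre [r], of the bump over the segment between [a] and
    [b] if this segment is contained in the support, and 0 otherwise. *)
Definition bump_level a b w r s : R := w * ln (s / bump_reach a b r s).

Lemma bump_reach_gt0 a b r s : a < b -> 0 < s -> 0 < bump_reach a b r s.
Proof.
move=> ab s0; rewrite lt_min s0 lt_max !normr_gt0 !subr_eq0 -negb_and.
by apply/negP => /andP[/eqP ar /eqP br]; move: ab; rewrite ar br ltxx.
Qed.

Lemma bump_reach_le a b r s : bump_reach a b r s <= s.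
Proof. by rewrite ge_min lexx. Qed.

Lemma measurable_bump_itv r s : measurable (bump_itv r s).
Proof. exact: measurable_itv. Qed.

Lemma bump_itvE r s x : (x \in bump_itv r s) = (`|x - r| <= s).
Proof. by rewrite /bump_itv mem_setE in_itv/= ler_distl. Qed.

Lemma lebesgue_measure_itvI (a b c d : R) :
  mu (`[a, b]%classic `&` `[c, d]%classic) =
  (Num.max 0 (Num.min b d - Num.max a c))%:E.
Proof.
have -> : `[a, b]%classic `&` `[c, d]%classic =
    `[Num.max a c, Num.min b d]%classic.
  apply/seteqP; split => x /=; rewrite !in_itv/= le_min ge_max.
    by move=> [/andP[-> ->] /andP[-> ->]].
  by move=> /andP[/andP[-> ->] /andP[-> ->]].
rewrite lebesgue_measure_itv/= lte_fin.
move: (Num.max a c) (Num.min b d) => lo hi.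
case: ifPn => [h|]; first by rewrite -EFinB max_r// subr_ge0 ltW.
by rewrite -leNgt => h; rewrite max_l// subr_le0.
Qed.

Lemma measure_shrunk_bump a b r s l : a < b -> 0 < s -> 0 <= l <= 1 ->
  (mu (`[a, b]%classic `&` bump_itv r (bump_reach a b r s * l)) <=
   (2 * l)%:E * mu (`[a, b]%classic `&` bump_itv r s))%E.
Proof.
move=> ab s0 l01; rewrite !lebesgue_measure_itvI -EFinM lee_fin.
have := @shrink_length R (a - r) (b - r) s l s0 l01 ltac:(lra).
rewrite /= [bump_reach _ _ _ _ * l]mulrC -/(bump_reach a b r s).
have minE q : Num.min b (r + q) - Num.max a (r - q) =
    Num.min (b - r) q - Num.max (a - r) (- q) :> R.
  have -> : Num.min b (r + q) = r + Num.min (b - r) q.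
    by rewrite addr_minr; congr Num.min; ring.
  have -> : Num.max a (r - q) = r + Num.max (a - r) (- q).
    by rewrite addr_maxr; congr Num.max; ring.
  ring.
by rewrite !minE.
Qed.

(** The inverse is continuous only off 0; writing it as a product with a real
    power avoids cutting the line at 0. *)
Lemma measurable_invr : measurable_fun setT (@GRing.inv R).
Proof.
have -> : @GRing.inv R = fun x => x * (x ^+ 2) `^ (-1).
  apply/funext => x; have [->|x0] := eqVneq x 0; first by rewrite invr0 mul0r.
  by rewrite powR_inv1 ?sqr_ge0// expr2 invfM mulrA divff ?mul1r.
apply: measurable_funM => //.
by apply: (measurableT_comp (@measurable_powR R (-1))).
Qed.

Lemma measurable_nneseries (D : set R) (u : nat -> R -> \bar R) :
  (forall i x, (0 <= u i x)%E) -> (forall i, measurable_fun D (u i)) ->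
  measurable_fun D (fun x => \sum_(0 <= i <oo) u i x)%E.
Proof. by move=> u0 mu_; apply: (@ge0_emeasurable_sum _ _ _ _ _ predT). Qed.

Lemma measurable_lnp_dist r s :
  measurable_fun setT (fun x => lnp (s / `|x - r|)).
Proof.
apply: measurable_maxr => //.
apply: (measurableT_comp (@measurable_ln R)).
apply: measurable_funM => //.
apply: (measurableT_comp measurable_invr).
apply: measurableT_comp => //.
exact: measurable_funB.
Qed.

(** Integrating [lnp_osc] term by term, the segments of radius M/2^j meet I in
    length at most 2^(1-j) |I /\ J| by [measure_shrunk_bump], a geometric
    series.  The point is that |I /\ J| on the right-hand side is additive in
    the bumps. *)
Lemma integral_log_bump_osc a b w r s : a < b -> 0 <= w -> 0 < s ->
  (\int[mu]_(x in `[a, b]) `|log_bump w r s x - bump_level a b w r s|%:E <=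
   (4 * w)%:E * mu (`[a, b]%classic `&` bump_itv r s))%E.
Proof.
move=> ab w0 s0; set M := bump_reach a b r s.
have M0 : 0 < M by exact: bump_reach_gt0.
have Ms : M <= s by exact: bump_reach_le.
pose ind j x : \bar R := (\1_(bump_itv r (M * 2^-1 ^+ j)) x)%:E.
have mind j : measurable_fun `[a, b] (ind j).
  by apply/measurable_EFinP; apply: measurable_indic; exact: measurable_bump_itv.
have ind0 j x : (0 <= ind j x)%E by rewrite lee_fin.
apply: (@le_trans _ _
    (\int[mu]_(x in `[a, b]) (w%:E * \sum_(0 <= j <oo) ind j x))%E).
  apply: ge0_le_integral => //.
  - apply/measurable_EFinP; apply: measurable_funTS.
    apply: measurableT_comp => //; apply: measurable_funB => //.
    by apply: measurable_funM => //; exact: measurable_lnp_dist.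
  - apply: measurable_funeM; exact: measurable_nneseries.
  - move=> x /=; rewrite in_itv/= => /andP[ax xb].
    rewrite /log_bump /bump_level -mulrBr normrM (ger0_norm w0) EFinM.
    rewrite lee_wpmul2l ?lee_fin//.
    have -> : (\sum_(0 <= j <oo) ind j x)%E =
        (\sum_(0 <= j <oo) ((`|x - r| <= M * 2^-1 ^+ j)%R%:R : R)%:E)%E.
      by apply: eq_eseriesr => j _; rewrite /ind indicE bump_itvE.
    apply: lnp_osc => //; rewrite /M /bump_reach gt_min ltxx/=.
    move=> /ltW; rewrite ge_max => /andP[as_ bs].
    rewrite le_min (_ : `|x - r| <= s); last first.
      by move: as_ bs; rewrite !ler_norml; lra.
    rewrite le_max; case: (ger0P (x - r)) => xr; rewrite !ler_normr.
      by rewrite (_ : x - r <= b - r) ?orbT//; lra.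
    by rewrite (_ : - (x - r) <= - (a - r)) ?orbT//; lra.
rewrite ge0_integralZl_EFin//; last 2 first.
- by move=> x _; exact: nneseries_ge0.
- exact: measurable_nneseries.
rewrite integral_nneseries//.
rewrite [(4 * w)]mulrC EFinM -muleA lee_wpmul2l ?lee_fin//.
set m := mu _; have m0 : (0 <= m)%E by exact: measure_ge0.
apply: (@le_trans _ _ (\sum_(0 <= j <oo) ((2 * m) * (2^-1 ^+ j)%:E))%E).
  apply: lee_nneseries => [j _ _|j _]; first exact: integral_ge0.
  rewrite /ind integral_indic//; last exact: measurable_bump_itv.
  rewrite [X in (mu X <= _)%E]setIC.
  apply: le_trans (measure_shrunk_bump _ _ _ _) _ => //.
    by rewrite exprn_ge0//= exprn_ile1//; lra.
  by rewrite EFinM muleAC.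
have mfin : m \is a fin_num by rewrite /m lebesgue_measure_itvI.
rewrite -(fineK mfin) -EFinM nneseriesZl; last first.
  by move=> *; rewrite lee_fin exprn_ge0.
apply: (@le_trans _ _ ((2 * fine m)%:E * 2%:E)%E).
  rewrite lee_wpmul2l ?nneseries_half_pow// lee_fin mulr_ge0// fine_ge0//.
by rewrite -!EFinM lee_fin; lra.
Qed.

End log_bump_integral.

(** * Almost everywhere statements for the Lebesgue measure *)

(** Makes the filter lemmas usable on [almost_everywhere lebesgue_measure] when
    the measure appears as a bare set function. *)
#[local] Instance ae_lebesgue_filter (R : realType) :
  Filter (nbhs (almost_everywhere (@lebesgue_measure R))).
Proof. exact: ae_filter_ringOfSetsType. Qed.

Section almost_everywhere.
Variable R : realType.
Local Notation mu := (@lebesgue_measure R).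

Lemma ae_itv_exists (a b : R) (P : R -> Prop) : a < b ->
  {ae mu, forall x, P x} -> exists x, `[a, b]%classic x /\ P x.
Proof.
move=> ab aeP; apply: contrapT => nex.
have neg : mu.-negligible (`[a, b]%classic : set R).
  by apply: negligibleS aeP => x xab Px; apply: nex; exists x.
have mD : measurable (`[a, b]%classic : set (measurableTypeR R)).
  exact: measurable_itv.
have := measure_negligible mD neg.
rewrite -[X in X = _]/(mu `[a, b]%classic).
rewrite lebesgue_measure_itv/= lte_fin ab => /eqP.
by rewrite -EFinD eqe subr_eq0 gt_eqF.
Qed.

Lemma countable_ae (A : set R) : countable A -> {ae mu, forall x, ~ A x}.
Proof.
move=> cA; exists A; split.
- exact: countable_measurable.
- exact: countable_lebesgue_measure0.
- by move=> x /= /contrapT.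
Qed.

Lemma ae_forall_int (P : int -> R -> Prop) :
  (forall m, {ae mu, forall x, P m x}) -> {ae mu, forall x, forall m, P m x}.
Proof.
move=> aeP.
have : {ae mu, forall x (n : nat), oapp (P ^~ x) True (unpickle n)}.
  by apply: ae_foralln => n; case: unpickle => [m|]; [exact: aeP|exact: aeW].
by apply: filterS => x Px m; have := Px (pickle m); rewrite pickleK.
Qed.

Lemma irrational_ae : {ae mu, forall x, irrational x}.
Proof.
by apply: countable_ae; apply: sub_countable (card_image_le _ _) _.
Qed.

Lemma lebesgue_measure_reflect (c : R) (A : set R) :
  measurable (A : set (measurableTypeR R)) ->
  pushforward mu (fun x : R => c - x : measurableTypeR R) A = mu A.
Proof.
move=> mA; apply/esym/lebesgue_measure_unique => //=.
  by move=> mh; exact: measurable_funB.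
move=> _ _ [[a b]] _ <-.
rewrite /pushforward (_ : _ @^-1` _ = `[c - b, c - a[%classic); last first.
  by apply/seteqP; split => x /=; rewrite !in_itv/=; lra.
rewrite !lebesgue_measure_itv/= !lte_fin ltrD2l ltrN2.
by case: ifP => // _; rewrite -!EFinD; congr EFin; ring.
Qed.

Lemma ae_reflect (P : R -> Prop) (c : R) : {ae mu, forall x, P x} ->
  {ae mu, forall x, P (c - x)}.
Proof.
move=> [N [mN N0 PN]].
have mh : measurable_fun setT
    (fun x : measurableTypeR R => c - x : measurableTypeR R).
  exact: measurable_funB.
exists ((fun x => c - x) @^-1` N); split.
- by rewrite -[X in measurable X]setTI; exact: mh.
- by rewrite -N0; exact: lebesgue_measure_reflect.
- by move=> x /= nP; apply: PN.
Qed.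

End almost_everywhere.

(** * A criterion for BMO *)

Section BMO_criterion.
Variable R : realType.
Local Notation mu := (@lebesgue_measure R).

Lemma bounded_interval_measure (I : set R) : is_interval I -> bounded_set I ->
  (0 < mu I)%E -> exists a b : R,
    [/\ a < b, I `<=` `[a, b]%classic & mu I = (b - a)%:E].
Proof.
move=> itvI bndI mu0.
have [M IM] : exists M : R, forall x, I x -> `|x| <= M.
  have [M [_ /(_ (M + 1))]] := bndI.
  by rewrite ltrDl ltr01 => /(_ isT) h; exists (M + 1).
have lbI : has_lbound I.
  by exists (- M) => x /IM; rewrite ler_norml => /andP[].
have ubI : has_ubound I by exists M => x /IM; rewrite ler_norml => /andP[].
have I_itv : [set` Rhull I] = I by apply: RhullK; rewrite inE.
have muI : mu I = if inf I < sup I then (sup I - inf I)%:E else 0%E.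
  have := lebesgue_measure_itv (Rhull I); rewrite I_itv => ->.
  by rewrite /Rhull (asboolT lbI) (asboolT ubI)/= lte_fin EFinB.
exists (inf I), (sup I).
move: mu0; rewrite muI; case: ifPn => [lt_ab _|]; last by rewrite ltxx.
split => // x Ix /=; rewrite in_itv/=.
by rewrite ge_inf// ub_le_sup.
Qed.

(** Any constant may be used in place of the mean, at the price of a factor 2,
    and bounded intervals may be replaced by closed segments. *)
Lemma has_BMO_osc (f : R -> R) (A : R) : locally_integrable setT f ->
  (forall a b, a < b -> exists c,
     (\int[mu]_(x in `[a, b]) `|f x - c|%:E <= (A * (b - a))%:E)%E) ->
  has_BMO setT f.
Proof.
move=> locf osc; split => //; have [mf _ intf] := locf.
apply: (@le_lt_trans _ _ (2 * A)%:E); last exact: ltry.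
apply: ge_ereal_sup => _ [I [_ itvI bndI muI0] <-].
have [a [b [ab Iab muI]]] := bounded_interval_measure itvI bndI muI0.
have [c oscc] := osc _ _ ab.
have mI : measurable (I : set (measurableTypeR R)).
  exact: is_interval_measurable.
have L0 : 0 < b - a by rewrite subr_gt0.
have fI : mu.-integrable I (EFin \o f).
  apply/integrableP; split; first by apply/measurable_EFinP; exact: measurable_funTS.
  apply: le_lt_trans (intf `[a, b]%classic _ _) => //; last exact: segment_compact.
  apply: ge0_subset_integral => //.
  by apply/measurable_EFinP; apply: measurable_funTS; exact: measurableT_comp.
have cI : mu.-integrable I (EFin \o cst c).
  apply/integrableP; split; first by apply/measurable_EFinP.
  rewrite [ltLHS](_ : _ = (`|c|%:E * mu I)%E); first by rewrite muI ltry.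
  by rewrite -integral_cst.
have fcI : mu.-integrable I (EFin \o (fun x => f x - c)).
  by have := integrableB mI fI cI.
have mabs d : measurable_fun I (fun x => `|f x - d|%:E).
  apply/measurable_EFinP; apply: measurableT_comp => //; apply: measurable_funB => //.
  exact: measurable_funTS.
have oscI : (\int[mu]_(x in I) `|f x - c|%:E <= (A * (b - a))%:E)%E.
  apply: le_trans oscc; apply: ge0_subset_integral => //.
  apply/measurable_EFinP; apply: measurableT_comp => //; apply: measurable_funB => //.
  exact: measurable_funTS.
have meanc : (`|c - mean f I|%:E * mu I <= (A * (b - a))%:E)%E.
  apply: le_trans oscI.
  have -> : (`|c - mean f I|%:E * mu I)%E = `|\int[mu]_(x in I) (f x - c)|%:E.
    rewrite RintegralB// Rintegral_cst// /mean muI -EFinM; congr EFin.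
    rewrite -[X in _ * X = _](gtr0_norm L0) -normrM distrC; congr `|_|.
    by rewrite /= mulrBl mulrAC mulVf ?mul1r ?gt_eqF ?muI.
  rewrite EFin_normr_Rintegral//.
  by apply: le_abse_integral => //; case/integrableP: fcI.
rewrite /iavg muI inver gt_eqF//.
rewrite -(@lee_pmul2l _ (b - a)%:E)// muleA -EFinM divff ?gt_eqF// mul1e -EFinM.
apply: (@le_trans _ _
    (\int[mu]_(x in I) (`|f x - c|%:E + cst `|c - mean f I|%:E x))%E).
  apply: ge0_le_integral => //.
  - exact: mabs.
  - apply: emeasurable_funD; [exact: mabs|exact: measurable_cst].
  - move=> x _; rewrite /= lee_fin.
    by rewrite (le_trans _ (ler_normD _ _))// addrA subrK.
rewrite ge0_integralD//; [|exact: mabs|by move=> x _; rewrite lee_fin].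
have -> : (b - a) * (2 * A) = A * (b - a) + A * (b - a) by ring.
by rewrite EFinD leeD// (le_trans _ meanc)// -integral_cst.
Qed.

End BMO_criterion.

(** * Superpositions of logarithmic bumps with bounded overlap *)

Section log_bump_series.
Variable R : realType.
Local Notation mu := (@lebesgue_measure R).
Variables (w r s : nat -> R) (K : R).
Hypothesis w0 : forall i, 0 <= w i.
Hypothesis s01 : forall i, 0 < s i <= 1.
Hypothesis K0 : 0 <= K.
Hypothesis overlap : {ae mu, forall x,
  (\sum_(0 <= i <oo) (w i * \1_(bump_itv (r i) (s i)) x)%:E <= K%:E)%E}.

Definition log_bump_series x : \bar R :=
  (\sum_(0 <= i <oo) (log_bump (w i) (r i) (s i) x)%:E)%E.

Let level a b i := bump_level a b (w i) (r i) (s i).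
Let bump i x := log_bump (w i) (r i) (s i) x.
Let osc a b x : \bar R := (\sum_(0 <= i <oo) `|bump i x - level a b i|%:E)%E.

Let bump_ge0 i x : 0 <= bump i x.
Proof. by rewrite mulr_ge0// lnp_ge0. Qed.

Let bump_meas i : measurable_fun setT (bump i).
Proof. by apply: measurable_funM => //; exact: measurable_lnp_dist. Qed.

Let osc_term_meas a b i : measurable_fun setT (fun x => `|bump i x - level a b i|%:E).
Proof.
apply/measurable_EFinP; apply: measurableT_comp => //.
by apply: measurable_funB => //; exact: bump_meas.
Qed.

Let osc_meas a b : measurable_fun setT (osc a b).
Proof. by apply: measurable_nneseries => // i; exact: osc_term_meas. Qed.

Let osc_ge0 a b x : (0 <= osc a b x)%E.
Proof. exact: nneseries_ge0. Qed.

Lemma measurable_log_bump_series : measurable_fun setT log_bump_series.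
Proof.
apply: measurable_nneseries => [i x|i]; first by rewrite lee_fin; exact: bump_ge0.
by apply/measurable_EFinP; exact: bump_meas.
Qed.

Lemma log_bump_series_ge0 x : (0 <= log_bump_series x)%E.
Proof. by apply: nneseries_ge0 => i _ _; rewrite lee_fin; exact: bump_ge0. Qed.

(** The bounds 4 w_i |I /\ J_i| on the oscillations of the bumps add up to 4 times
    the integral over I of the overlap function. *)
Lemma integral_osc a b : a < b ->
  (\int[mu]_(x in `[a, b]) osc a b x <= (4 * K * (b - a))%:E)%E.
Proof.
move=> ab.
have mD : measurable (`[a, b]%classic : set (measurableTypeR R)).
  exact: measurable_itv.
rewrite integral_nneseries//; last first.
  by move=> i; apply: measurable_funTS; exact: osc_term_meas.
pose ind i x : \bar R := (w i * \1_(bump_itv (r i) (s i)) x)%:E.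
have ind0 i x : (0 <= ind i x)%E by rewrite lee_fin mulr_ge0.
have mind i : measurable_fun setT (ind i).
  apply/measurable_EFinP; apply: measurable_funM => //.
  by apply: measurable_indic; exact: measurable_bump_itv.
apply: (@le_trans _ _
    (\sum_(0 <= i <oo) (4%:E * \int[mu]_(x in `[a, b]) ind i x))%E).
  apply: lee_nneseries => [i _ _|i _]; first exact: integral_ge0.
  have /andP[si0 _] := s01 i.
  apply: le_trans (integral_log_bump_osc (r i) ab (w0 i) si0) _.
  rewrite EFinM -muleA lee_wpmul2l ?lee_fin//.
  rewrite /ind; under eq_integral do rewrite EFinM.
  rewrite ge0_integralZl_EFin//; last first.
    apply/measurable_EFinP.
    by apply: measurable_indic; exact: measurable_bump_itv.
  rewrite integral_indic//; last exact: measurable_bump_itv.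
  by rewrite setIC.
rewrite nneseriesZl; last by move=> i _; exact: integral_ge0.
rewrite -integral_nneseries//; last first.
  by move=> i; apply: measurable_funTS; exact: mind.
rewrite -mulrA EFinM lee_wpmul2l ?lee_fin//.
apply: (@le_trans _ _ (\int[mu]_(x in `[a, b]) cst K%:E x)%E).
  apply: ae_ge0_le_integral => //.
  - by move=> x _; exact: nneseries_ge0.
  - by apply: measurable_funTS; apply: measurable_nneseries.
  - by move: overlap; apply: filterS => x.
rewrite integral_cst// -[X in (_ * X <= _)%E]/(mu `[a, b]%classic).
rewrite lebesgue_measure_itv/= lte_fin ab.
by rewrite -EFinD -EFinM.
Qed.

Let level_long a b i : 2 <= b - a -> level a b i = 0.
Proof.
move=> ab; have /andP[s0 s1] := s01 i; rewrite /level /bump_level /bump_reach min_l.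
  by rewrite divff ?gt_eqF// ln1 mulr0.
rewrite le_max !ler_normr.
case: (leP (r i) ((a + b) / 2)) => rab.
  by rewrite (_ : s i <= b - r i) ?orbT//; lra.
by rewrite (_ : s i <= - (a - r i)) ?orbT//; lra.
Qed.

(** No support contains a segment of length at least 2, so all the levels are 0
    there and the oscillation bound becomes a bound on the integral. *)
Lemma integral_log_bump_series a b : 2 <= b - a ->
  (\int[mu]_(x in `[a, b]) log_bump_series x <= (4 * K * (b - a))%:E)%E.
Proof.
move=> ab; have ab' : a < b by lra.
apply: le_trans (integral_osc ab'); rewrite le_eqVlt; apply/orP; left; apply/eqP.
apply: eq_integral => x _; apply: eq_eseriesr => i _.
by rewrite level_long// subr0 ger0_norm//; exact: bump_ge0.
Qed.

Lemma log_bump_series_fin : {ae mu, forall x, (log_bump_series x < +oo)%E}.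
Proof.
have : {ae mu, forall x (n : nat), `[- n.+1%:R, n.+1%:R]%classic x ->
    log_bump_series x \is a fin_num}.
  apply: ae_foralln => n.
  have mD : measurable (`[- n.+1%:R, n.+1%:R]%classic : set (measurableTypeR R)).
    exact: measurable_itv.
  apply: (integrable_ae mD); apply/integrableP; split.
    by apply: measurable_funTS; exact: measurable_log_bump_series.
  under eq_integral do rewrite gee0_abs ?log_bump_series_ge0//.
  apply: le_lt_trans (integral_log_bump_series _) (ltry _).
  have : 1 <= (n.+1%:R : R) by rewrite ler1n.
  by lra.
apply: filterS => x /(_ (Num.bound `|x|)) fin_x.
rewrite ltey_eq fin_x//= in_itv/= -ler_norml.
apply: le_trans (ltW (archi_boundP (normr_ge0 x))) _.
by rewrite ler_nat leqnSn.
Qed.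

Let level_ge0 a b i : a < b -> 0 <= level a b i.
Proof.
move=> ab; have /andP[s0 s1] := s01 i.
rewrite /level /bump_level mulr_ge0// ln_ge0// ler_pdivlMr ?bump_reach_gt0//.
by rewrite mul1r ge_min lexx.
Qed.

Let osc_fin a b : a < b ->
  {ae mu, forall x, `[a, b]%classic x -> osc a b x \is a fin_num}.
Proof.
move=> ab.
have mD : measurable (`[a, b]%classic : set (measurableTypeR R)).
  exact: measurable_itv.
apply: (integrable_ae mD); apply/integrableP; split.
  by apply: measurable_funTS; exact: osc_meas.
under eq_integral do rewrite gee0_abs ?osc_ge0//.
exact: le_lt_trans (integral_osc ab) (ltry _).
Qed.

Let level_sum a b : \bar R := (\sum_(0 <= i <oo) (level a b i)%:E)%E.

Let level_le a b x : a < b -> (level_sum a b <= log_bump_series x + osc a b x)%E.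
Proof.
move=> ab; rewrite /log_bump_series /osc -nneseriesD//; last first.
  by move=> i _ _; rewrite lee_fin; exact: bump_ge0.
apply: lee_nneseries => [i _ _|i _]; first by rewrite lee_fin level_ge0.
rewrite -EFinD lee_fin -/(bump i x).
by have := ler_norm (level a b i - bump i x); rewrite distrC; lra.
Qed.

Let bump_le a b x : a < b -> (log_bump_series x <= level_sum a b + osc a b x)%E.
Proof.
move=> ab; rewrite /level_sum /osc -nneseriesD//; last first.
  by move=> i _ _; rewrite lee_fin level_ge0.
apply: lee_nneseries => [i _ _|i _]; first by rewrite lee_fin; exact: bump_ge0.
rewrite -EFinD lee_fin -/(bump i x).
by have := ler_norm (bump i x - level a b i); lra.
Qed.

Let level_sum_ge0 a b : a < b -> (0 <= level_sum a b)%E.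
Proof. by move=> ab; apply: nneseries_ge0 => i _ _; rewrite lee_fin level_ge0. Qed.

(* The sum of the levels is squeezed between two quantities that are finite at
   almost every point of the segment, hence at one such point. *)
Let level_sum_fin a b : a < b -> level_sum a b \is a fin_num.
Proof.
move=> ab; have [x [xab [Gx /(_ xab) ox]]] : exists x, `[a, b]%classic x /\
    ((log_bump_series x < +oo)%E /\
     (`[a, b]%classic x -> osc a b x \is a fin_num)).
  apply: (ae_itv_exists ab); apply: filterS2 log_bump_series_fin (osc_fin ab).
  by move=> x; split.
rewrite ge0_fin_numE ?level_sum_ge0//; apply: le_lt_trans (level_le x ab) _.
by rewrite lte_add_pinfty// ltey_eq ox.
Qed.

Variables (F : R -> \bar R) (C : R).
Hypothesis F0 : forall x, (0 <= F x)%E.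
Hypothesis F_meas : measurable_fun setT F.
Hypothesis C0 : 0 <= C.
Hypothesis F_near : {ae mu, forall x,
  (F x <= log_bump_series x + C%:E)%E /\ (log_bump_series x <= F x + C%:E)%E}.

Lemma near_log_bump_fin : {ae mu, forall x, F x \is a fin_num}.
Proof.
apply: filterS2 F_near log_bump_series_fin => x [FG _] Gx.
rewrite ge0_fin_numE//; apply: le_lt_trans FG _.
by rewrite lte_add_pinfty// ltry.
Qed.

Local Notation f := (fine \o F).

Let f_meas : measurable_fun setT f.
Proof. exact: measurableT_comp F_meas. Qed.

Let integral_cstC a b : a < b ->
  (\int[mu]_(x in `[a, b]) cst C%:E x = (C * (b - a))%:E)%E.
Proof.
move=> ab; rewrite integral_cst//.
rewrite -[X in (_ * X = _)%E]/(mu `[a, b]%classic).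
by rewrite lebesgue_measure_itv/= lte_fin ab -EFinD -EFinM.
Qed.

Lemma near_log_bump_osc a b : a < b -> exists c,
  (\int[mu]_(x in `[a, b]) `|f x - c|%:E <= ((4 * K + C) * (b - a))%:E)%E.
Proof.
move=> ab; exists (fine (level_sum a b)).
have mD : measurable (`[a, b]%classic : set (measurableTypeR R)).
  exact: measurable_itv.
apply: (@le_trans _ _ (\int[mu]_(x in `[a, b]) (osc a b x + cst C%:E x))%E).
  apply: ae_ge0_le_integral => //.
  - apply/measurable_EFinP; apply: measurable_funTS; apply: measurableT_comp => //.
    exact: measurable_funB.
  - by move=> x _; rewrite adde_ge0// ?osc_ge0// lee_fin.
  - apply: emeasurable_funD; last exact: measurable_cst.
    by apply: measurable_funTS; exact: osc_meas.
  apply: filterS2 F_near near_log_bump_fin => x [FG GF] Ffin _.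
  have := level_le x ab; have := bump_le x ab; have := level_sum_fin ab.
  have := osc_ge0 a b x; have := log_bump_series_ge0 x; move: FG GF.
  rewrite /=; case: (F x) Ffin => [y| |]// _.
  case: (log_bump_series x) => [g| |]//; case: (level_sum a b) => [c| |]//.
  case: (osc a b x) => [t| |]//; last by move=> *; rewrite /= leey.
  rewrite -!EFinD !lee_fin /=; move=> *.
  by rewrite ler_norml; lra.
rewrite ge0_integralD//; last by apply: measurable_funTS; exact: osc_meas.
rewrite mulrDl EFinD leeD ?integral_osc//.
by rewrite le_eqVlt; apply/orP; left; apply/eqP; exact: integral_cstC.
Qed.

Lemma near_log_bump_locally_integrable : locally_integrable setT f.
Proof.
suff compact_int (Q : set R) : compact Q -> (\int[mu]_(x in Q) `|f x|%:E < +oo)%E.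
  by split => // [|Q _ cQ]; [exact: openT|exact: compact_int].
move=> cQ.
have [M [M1 QM]] : exists M : R, 1 <= M /\ Q `<=` `[- M, M]%classic.
  have [M [_ bM]] := compact_bounded cQ.
  exists (Num.max 1 (M + 1)); split; first by rewrite le_max lexx.
  move=> x Qx /=; rewrite in_itv/= -ler_norml le_max.
  by rewrite (bM (M + 1))// ?orbT// ltrDl.
have mD : measurable (`[- M, M]%classic : set (measurableTypeR R)).
  exact: measurable_itv.
have mabsf D : measurable_fun D (fun x => `|f x|%:E).
  by apply/measurable_EFinP; apply: measurable_funTS; exact: measurableT_comp.
have sub : (\int[mu]_(x in Q) `|f x|%:E <=
    \int[mu]_(x in `[(- M)%R, M]) `|f x|%:E)%E.
  by apply: ge0_subset_integral => //; [exact: compact_measurable|exact: mabsf].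
apply: (le_lt_trans sub).
apply: (@le_lt_trans _ _
    (\int[mu]_(x in `[(- M)%R, M]) (log_bump_series x + cst C%:E x))%E).
  apply: ae_ge0_le_integral => //.
  - exact: mabsf.
  - by move=> x _; rewrite adde_ge0 ?log_bump_series_ge0// lee_fin.
  - apply: emeasurable_funD; last exact: measurable_cst.
    by apply: measurable_funTS; exact: measurable_log_bump_series.
  apply: filterS2 F_near near_log_bump_fin => x [FG _] Ffin _.
  by rewrite /= ger0_norm ?fine_ge0// fineK.
rewrite ge0_integralD//; last 2 first.
- by move=> x _; exact: log_bump_series_ge0.
- by apply: measurable_funTS; exact: measurable_log_bump_series.
rewrite integral_cstC; last by lra.
rewrite lte_add_pinfty ?ltry//.
apply: le_lt_trans (integral_log_bump_series _) (ltry _); lra.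
Qed.

Lemma near_log_bump_BMO : has_BMO setT f.
Proof.
exact: has_BMO_osc near_log_bump_locally_integrable near_log_bump_osc.
Qed.

End log_bump_series.

(** * Convergents of the alpha-continued fraction *)

Section convergents.
Variables (R : realType) (alpha x : R).

Definition centered_rem (alpha z : R) : R :=
  z - (Num.floor (z - alpha + 1))%:~R.

(** The signed n-th remainder: its absolute value is the n-th iterate of [cfmap]
    and its sign is the sign of the next step of the expansion. *)
Fixpoint cfrem (alpha x : R) (n : nat) : R :=
  if n is m.+1 then centered_rem alpha `|cfrem alpha x m|^-1
  else centered_rem alpha x.

(** The pair formed by the convergents of indices n - 1 and n, where a convergent
    p/q is encoded as (p, q).  The expansion starts with the integer m such that
    x - m lies in [alpha - 1, alpha). *)
Fixpoint conv_pair (alpha x : R) (n : nat) : (int * int) * (int * int) :=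
  if n is m.+1 then
    let: (u, v) := conv_pair alpha x m in
    let a := Num.floor (`|cfrem alpha x m|^-1 - alpha + 1) in
    let e := sgz (cfrem alpha x m) in
    (v, (a * v.1 + e * u.1, a * v.2 + e * u.2))
  else ((1, 0), (Num.floor (x - alpha + 1), 1)).

Definition lin_err (x : R) (v : int * int) : R := v.2%:~R * x - v.1%:~R.

Lemma centered_rem_itv z : alpha - 1 <= centered_rem alpha z < alpha.
Proof.
have /andP[] := real_floor_itv (num_real (z - alpha + 1)).
by rewrite /centered_rem intrD mulr1z => ? ?; lra.
Qed.

Lemma cfrem_itv n : alpha - 1 <= cfrem alpha x n < alpha.
Proof. by case: n => [|n]; exact: centered_rem_itv. Qed.

Lemma iter_cfmap n :
  iter n (cfmap alpha) `|centered_rem alpha x| = `|cfrem alpha x n|.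
Proof. by elim: n => // n IHn; rewrite iterS IHn. Qed.

Lemma lin_err_neq0 (v : int * int) : irrational x -> 1 <= v.2 -> lin_err x v != 0.
Proof.
move=> x_irr v2; apply/eqP => e0; apply: x_irr; apply/rationalP.
exists v.1, `|v.2|%N.
have v20 : (v.2%:~R : R) != 0 by rewrite intr_eq0; lia.
have -> : (`|v.2|%N%:R : R) = v.2%:~R by rewrite natr_absz ger0_norm//; lia.
by apply: (mulIf v20); rewrite mulfVK//; move: e0; rewrite /lin_err; lra.
Qed.

(** A negative remainder has absolute value at most 1 - alpha <= 1/2, which is
    what forces the next digit to be at least 2 and keeps denominators
    nondecreasing in spite of the negative signs. *)
Lemma digit_ge (y : R) : 2^-1 <= alpha <= 1 -> y != 0 -> alpha - 1 <= y < alpha ->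
  (if y < 0 then 2 else 1) <= Num.floor (`|y|^-1 - alpha + 1).
Proof.
move=> /andP[a2 a1] y0 /andP[ya yb].
have ypos : 0 < `|y| by rewrite normr_gt0.
have yV : `|y| * `|y|^-1 = 1 by rewrite divff// gt_eqF.
have Vpos : 0 < `|y|^-1 by rewrite invr_gt0.
case: (ltP y 0) => y0'; rewrite floor_ge_int_tmp//.
  rewrite ltr0_norm// in ypos yV Vpos *; nra.
rewrite ger0_norm// in ypos yV Vpos *; nra.
Qed.

Lemma conv_pairS n : (conv_pair alpha x n.+1).1 = (conv_pair alpha x n).2.
Proof. by rewrite /=; case: (conv_pair alpha x n). Qed.

Definition convergent_invariant (y : R) (u v : int * int) :=
  [/\ (u.1 * v.2 - v.1 * u.2) ^+ 2 = 1,
      lin_err x v = - y * lin_err x u,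
      0 <= u.2 <= v.2 & 1 <= v.2].

Hypothesis alpha_range : 2^-1 <= alpha <= 1.
Hypothesis x_irr : irrational x.

Lemma conv_pair_inv n : convergent_invariant (cfrem alpha x n)
  (conv_pair alpha x n).1 (conv_pair alpha x n).2.
Proof.
elim: n => [|n]; first by split => //=; rewrite /lin_err /centered_rem /=; ring.
rewrite /=; case: (conv_pair alpha x n) (cfrem_itv n) => u v /=.
set y := cfrem alpha x n => yI [det err ord v2].
have v0 := lin_err_neq0 x_irr v2.
have y0 : y != 0.
  by apply: contra_neq v0 => y0; rewrite err y0 oppr0 mul0r.
have sg2 : sgz y * sgz y = 1 by case: (sgzP y) y0.
have ge1 := digit_ge alpha_range y0 yI.
split => /=.
- move: sg2 det; set a := Num.floor _; set e := sgz y => e2 det.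
  transitivity ((u.1 * v.2 - v.1 * u.2) ^+ 2 * (e * e)); last by rewrite det e2.
  by ring.
- have eu : lin_err x u = - y^-1 * lin_err x v.
    by rewrite err mulrA mulrNN mulVf// mul1r.
  have ey : (sgz y)%:~R * y^-1 = `|y|^-1.
    by case: (sgzP y) y0 => // _ _; rewrite ?mul1r// mulN1r invrN.
  rewrite /centered_rem.
  transitivity ((Num.floor (`|y|^-1 - alpha + 1))%:~R * lin_err x v
                + (sgz y)%:~R * lin_err x u).
    by rewrite /lin_err /= !intrD !intrM; ring.
  by rewrite eu mulrA mulrN ey; ring.
- case: (sgzP y) y0 ge1 => // _ _.
  + by set a := Num.floor _ => a1; apply/andP; split; nia.
  + by set a := Num.floor _ => a1; apply/andP; split; nia.
- case: (sgzP y) y0 ge1 => // _ _; set a := Num.floor _ => a1; nia.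
Qed.

End convergents.

Lemma absz_lt1 (z : int) : `|z| < 1 -> z = 0.
Proof. lia. Qed.

Section approximation.
Variables (R : realType) (alpha x : R).
Hypothesis alpha_range : 2^-1 <= alpha <= 1.
Hypothesis x_irr : irrational x.

(* Here [beta n] is beta_{n-1}, in accordance with the shift in [cfbeta]. *)
Local Notation y := (cfrem alpha x).
Local Notation beta n := (cfbeta alpha n `|centered_rem alpha x|).
Local Notation conv_den n := (conv_pair alpha x n).2.2.
Local Notation conv_num n := (conv_pair alpha x n).2.1.

Lemma cfrem_neq0 n : y n != 0.
Proof.
have [_ err _ v2] := conv_pair_inv alpha_range x_irr n.
apply/eqP => y0; have := lin_err_neq0 x_irr v2.
by rewrite err y0 oppr0 mul0r eqxx.
Qed.

Lemma cfbetaS n : beta n.+1 = beta n * `|y n|.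
Proof. by rewrite /cfbeta big_ord_recr/= iter_cfmap. Qed.

Lemma cfbetaE n : beta n = `|lin_err x (conv_pair alpha x n).1|.
Proof.
elim: n => [|n IHn].
  by rewrite /cfbeta big_ord0 /lin_err/= mul0r sub0r normrN normr1.
have [_ err _ _] := conv_pair_inv alpha_range x_irr n.
by rewrite cfbetaS IHn conv_pairS err normrM normrN mulrC.
Qed.

Lemma cfrem_norm n : 0 < `|y n| < 1.
Proof.
rewrite normr_gt0 cfrem_neq0 ltr_norml /=.
by move: alpha_range (cfrem_itv alpha x n) => /andP[? ?] /andP[? ?]; lra.
Qed.

Lemma cfbeta_gt0 n : 0 < beta n.
Proof.
elim: n => [|n IHn]; first by rewrite /cfbeta big_ord0.
by rewrite cfbetaS mulr_gt0//; case/andP: (cfrem_norm n).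
Qed.

Lemma cfbeta_ltS n : beta n.+1 < beta n.
Proof.
by rewrite cfbetaS; have := cfbeta_gt0 n; case/andP: (cfrem_norm n); nra.
Qed.

Lemma conv_den_ge1 n : 1 <= (conv_den n)%:~R :> R.
Proof.
by have [_ _ _ v2] := conv_pair_inv alpha_range x_irr n; rewrite ler1z.
Qed.

(** The determinant identity reads beta_{n-1} (q_n + q_{n-1} y_n) = 1, where
    0 <= q_{n-1} <= q_n and -1/2 <= y_n < 1. *)
Lemma conv_den_beta n :
  let t := (conv_den n)%:~R * beta n in
  [/\ 2^-1 <= t, t <= 2 & `|t - 1| <= 2 * `|y n|].
Proof.
have := cfbeta_gt0 n; have := conv_den_ge1 n; rewrite /= cfbetaE.
have [det err ord v2] := conv_pair_inv alpha_range x_irr n.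
move: det err ord v2 => /=.
case: (conv_pair alpha x n) => -[u1 u2] [v1 v2] /= det err ord _.
set b := `|lin_err x (u1, u2)|; set q : R := v2%:~R => q1 b0.
have {ord} : 0 <= (u2%:~R : R) <= q.
  by case/andP: ord => u20 u2v2; rewrite /q ler0z ler_int u20 u2v2.
set q' : R := u2%:~R => /andP[q'0 q'q].
have /andP[y1 y2] := cfrem_itv alpha x n; have /andP[a2 a1] := alpha_range.
have s0 : 0 < q + q' * y n by nra.
have b1 : b * (q + q' * y n) = 1.
  rewrite /b -[q + _]gtr0_norm// -normrM.
  have -> : lin_err x (u1, u2) * (q + q' * y n) = (v1 * u2 - u1 * v2)%:~R.
    rewrite mulrDr (_ : _ * (q' * _) = - (q' * lin_err x (v1, v2))); last first.
      by rewrite err; ring.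
    by rewrite /lin_err/= /q /q' rmorphB/= !rmorphM/=; ring.
  have : (v1 * u2 - u1 * v2) ^+ 2 = 1 by rewrite -det; ring.
  by move/eqP; rewrite sqrf_eq1 => /orP[] /eqP ->; rewrite ?mulrN1z ?normrN ?normr1.
have yn0 : 0 <= `|y n| by [].
have t2 : q * b <= 2 by nra.
split => //; first by nra.
rewrite -b1 (_ : _ - _ = - (b * q' * y n)); last by ring.
rewrite normrN normrM ger0_norm; last by nra.
by rewrite ler_wpM2r//; nra.
Qed.

(** The product is |1 - a t| with t = |y_n| and a >= 1 the digit: for a positive
    next remainder it is at most both 1 - t and t, and for a negative one it is
    at most t (1 - alpha). *)
Lemma cfrem_mul_le n : `|y n| * `|y n.+1| <= 2^-1.
Proof.
have /andP[t0 t1] := cfrem_norm n.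
have ge1 := digit_ge alpha_range (cfrem_neq0 n) (cfrem_itv alpha x n).
have /andP[c0 c1] := cfrem_itv alpha x n.+1; have /andP[a2 a1] := alpha_range.
move: c0 c1; rewrite /= /centered_rem; set a := Num.floor _ => c0 c1.
have {}ge1 : (1 : R) <= a%:~R by rewrite ler1z; apply: le_trans ge1; case: ifP.
move: t0 t1 c0 c1; set t := `|y n| => t0 t1 c0 c1.
have tV : t * t^-1 = 1 by rewrite divff// gt_eqF.
set c := t^-1 - a%:~R in c0 c1 *.
have tc : t * c = 1 - a%:~R * t by rewrite /c mulrBr tV [t * _]mulrC.
have ta : t <= a%:~R * t by nra.
case: (ger0P c) => c00; last by nra.
have tct : t * c <= t by nra.
by lra.
Qed.

Lemma cfbeta_half n : beta n.+2 <= beta n / 2.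
Proof.
rewrite !cfbetaS -mulrA ler_pM2l ?cfbeta_gt0//; exact: cfrem_mul_le.
Qed.

Lemma sum_cfbeta_le n : \sum_(i < n) beta i <= 4.
Proof.
(* The tail of the series is at most 2 (beta_{n-1} + beta_n), by halving. *)
suff : \sum_(i < n) beta i + 2 * (beta n + beta n.+1) <= 4.
  by have := cfbeta_gt0 n; have := cfbeta_gt0 n.+1; lra.
elim: n => [|n IHn].
  by rewrite big_ord0; have := cfbeta_ltS 0; rewrite /cfbeta big_ord0; lra.
by rewrite big_ord_recr/=; have := cfbeta_half n; lra.
Qed.

Lemma cfbeta_nincr m n : (m <= n)%N -> beta n <= beta m.
Proof.
by move/subnK => <-; elim: (n - m)%N => // k; apply/le_trans/ltW/cfbeta_ltS.
Qed.

Lemma cfbeta_small (e : R) : 0 < e -> exists n, beta n < e.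
Proof.
move=> e0; have [n ne] : exists n : nat, 4 / e < n%:R.
  by exists (Num.bound (4 / e)); apply: archi_boundP; rewrite divr_ge0// ltW.
exists n; rewrite ltNge; apply/negP => en.
have : n%:R * e <= 4.
  apply: le_trans (sum_cfbeta_le n).
  rewrite -[n in n%:R]card_ord -sum1_card natr_sum mulr_suml ler_sum// => i _.
  by rewrite mul1r (le_trans en)// cfbeta_nincr// ltnW.
by rewrite -ler_pdivlMr// leNgt ne.
Qed.

Definition convergent n : rat := (conv_num n)%:~R / (conv_den n)%:~R.

Lemma convergentE n :
  numq (convergent n) = conv_num n /\ denq (convergent n) = conv_den n.
Proof.
have [det _ _ v2] := conv_pair_inv alpha_range x_irr n.
have cop : coprime `|conv_num n| `|conv_den n|.
  rewrite -[coprime _ _]/(coprimez _ _).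
  move: det; case: (conv_pair alpha x n) => -[u1 u2] [v1 w2] /= det.
  apply/coprimezP; move/eqP: det; rewrite sqrf_eq1 => /orP[] /eqP det.
    by exists (- u2, u1); rewrite /= -det; ring.
  by exists (u2, - u1) => /=; apply: oppr_inj; rewrite -det; ring.
split; first by rewrite coprimeq_num// gtr0_sg ?mul1r//; lia.
by rewrite coprimeq_den//; case: eqP => ?; lia.
Qed.

Lemma convergent_err n :
  (conv_den n)%:~R * `|x - ratr (convergent n)| = beta n.+1.
Proof.
rewrite cfbetaE conv_pairS /lin_err; have := conv_den_ge1 n => q1.
rewrite -[in LHS](ger0_norm (_ : 0 <= (conv_den n)%:~R)); last by lra.
rewrite -normrM; congr `|_|; rewrite mulrBr; congr (_ - _).
rewrite /convergent fmorph_div/= !ratr_int mulrC mulfVK//.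
by rewrite gt_eqF//; lra.
Qed.

Lemma convergent_inj : injective convergent.
Proof.
have lt m n : (m < n)%N -> convergent m <> convergent n.
  move=> mn e; have := convergent_err m; rewrite -(convergentE m).2 e.
  rewrite (convergentE n).2 convergent_err => be.
  by have := lt_le_trans (cfbeta_ltS n) (cfbeta_nincr mn); rewrite be ltxx.
by move=> m n e; case: (ltngtP m n) => // /lt; rewrite e.
Qed.

(** A Legendre type criterion.  Take n least with q beta_n < 1/2, so that
    q_n <= 2 / beta_{n-1} <= 4 q.  Then the integer p q_n - p_n q has absolute
    value at most q beta_n + q_n |q x - p| < 1/2 + 4 q / (8 q) = 1. *)
Lemma good_approx_convergent (r : rat) :
  (denq r)%:~R ^+ 2 * `|x - ratr r| <= 8^-1 -> exists n, r = convergent n.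
Proof.
set p : R := (numq r)%:~R; set q : R := (denq r)%:~R.
have q1 : 1 <= q by rewrite /q ler1z -gtz0_ge1 denq_gt0.
have rE : ratr r = p / q by [].
have qx : q * `|x - ratr r| = `|q * x - p|.
  rewrite -[q in LHS]ger0_norm; last lra.
  rewrite -normrM mulrBr rE mulrCA divff ?mulr1// gt_eqF//; lra.
rewrite expr2 -mulrA qx => good.
have [n0 n0P] := @cfbeta_small (2^-1 / q) (ltac:(by rewrite divr_gt0//; lra)).
have : exists n, beta n < 2^-1 / q by exists n0.
case/ex_minnP => -[|n]; first by rewrite /cfbeta big_ord0 ltr_pdivlMr; lra.
move=> bS min; exists n.
have bn : 2^-1 / q <= beta n.
  by rewrite leNgt; apply/negP => /min; rewrite ltnn.
have [tge tle _] := conv_den_beta n.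
have qn1 := conv_den_ge1 n.
set qn : R := (conv_den n)%:~R in tge tle qn1.
set pn : R := (conv_num n)%:~R.
have qn4 : qn <= 4 * q.
  move: bn; rewrite ler_pdivrMr; last by lra.
  have := cfbeta_gt0 n; nra.
have dn : `|qn * x - pn| = beta n.+1 by rewrite cfbetaE conv_pairS.
have bq : q * beta n.+1 < 2^-1 by move: bS; rewrite ltr_pdivlMr; lra.
have : `|(numq r * conv_den n - conv_num n * denq r)%:~R| < (1 : R).
  have -> : (numq r * conv_den n - conv_num n * denq r)%:~R =
      q * (qn * x - pn) - qn * (q * x - p).
    by rewrite rmorphB/= !rmorphM/= -/p -/q -/pn -/qn; ring.
  apply: le_lt_trans (ler_normB _ _) _.
  rewrite !normrM dn (ger0_norm (_ : 0 <= q)) ?(ger0_norm (_ : 0 <= qn)); [|lra|lra].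
  have e0 : 0 <= `|q * x - p| by [].
  have : qn * `|q * x - p| <= 2^-1 by nra.
  by lra.
rewrite -intr_norm ltrz1 => cross.
have {}cross : numq r * conv_den n = conv_num n * denq r.
  by apply/subr0_eq/absz_lt1.
rewrite -[LHS]divq_num_den /convergent; apply/eqP.
have qn0 : ((conv_den n)%:~R : rat) != 0.
  have [_ _ _ v2] := conv_pair_inv alpha_range x_irr n.
  by rewrite intr_eq0 gt_eqF// (lt_le_trans ltr01 v2).
by rewrite eqr_div ?intr_eq0 ?denq_eq0// -?rmorphM ?cross// -(intr_eq0 rat).
Qed.

End approximation.

(** * The Brjuno series as a superposition of bumps *)

Section rational_bumps.
Variables (R : realType) (k : nat).

(** The bumps are indexed by the natural numbers through [pickle]; an index that
    does not encode a rational gets weight 0. *)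
Definition rat_weight (i : nat) : R :=
  if pickle_inv i is Some q then (denq q)%:~R ^- k else 0.

Definition rat_center (i : nat) : R :=
  if pickle_inv i is Some q then ratr q else 0.

Definition rat_radius (i : nat) : R :=
  if pickle_inv i is Some q then (8 * (denq q)%:~R ^+ 2)^-1 else 1.

Lemma denq_ge1 (q : rat) : 1 <= (denq q)%:~R :> R.
Proof. by rewrite ler1z -gtz0_ge1 denq_gt0. Qed.

Lemma rat_weight_ge0 i : 0 <= rat_weight i.
Proof.
rewrite /rat_weight; case: pickle_inv => // q; rewrite invr_ge0 exprn_ge0//.
by have := denq_ge1 q; lra.
Qed.

Lemma rat_radius01 i : 0 < rat_radius i <= 1.
Proof.
rewrite /rat_radius; case: pickle_inv => [q|]; last by rewrite ltr01 lexx.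
have q1 := denq_ge1 q; have q2 : 1 <= (denq q)%:~R ^+ 2 :> R by rewrite exprn_ege1.
by apply/andP; split; rewrite ?invr_gt0 ?invf_le1; lra.
Qed.

Definition rat_log_bumps : R -> \bar R :=
  log_bump_series rat_weight rat_center rat_radius.

End rational_bumps.

Section comparison.
Variables (R : realType) (k : nat) (alpha x : R).
Hypothesis k_ge1 : (1 <= k)%N.
Hypothesis alpha_range : 2^-1 <= alpha <= 1.
Hypothesis x_irr : irrational x.

Local Notation y := (cfrem alpha x).
Local Notation beta n := (cfbeta alpha n `|centered_rem alpha x|).
Local Notation q n := ((conv_pair alpha x n).2.2%:~R : R).
Local Notation e := (fun n => pickle (convergent alpha x n)).

Let e_inj : injective e.
Proof.
by move=> m n /(pcan_inj pickleK)/(convergent_inj alpha_range x_irr).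
Qed.

Let weightE n : rat_weight R k (e n) = q n ^- k.
Proof.
by rewrite /rat_weight pickleK_inv (convergentE alpha_range x_irr n).2.
Qed.

Let weight_le n : q n ^- k <= 2 * beta n.
Proof.
have q1 := conv_den_ge1 alpha_range x_irr n.
have [tge _ _] := conv_den_beta alpha_range x_irr n.
have qk : q n <= q n ^+ k by rewrite -[leLHS]expr1 ler_weXn2l.
have qk0 : 0 < q n ^+ k by rewrite exprn_gt0//; lra.
apply: (@le_trans _ _ (q n)^-1); first by rewrite lef_pV2 ?posrE//; lra.
by rewrite -div1r ler_pdivrMr; lra.
Qed.

Let near_rat_convergent i p : pickle_inv i = Some p ->
  `|x - ratr p| <= (8 * (denq p)%:~R ^+ 2)^-1 -> exists n, i = e n.
Proof.
move=> ip near_p; have [n pn] : exists n, p = convergent alpha x n.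
  apply: good_approx_convergent => //.
  have d0 : 0 < (denq p)%:~R ^+ 2 :> R.
    by rewrite exprn_gt0//; have := denq_ge1 R p; lra.
  by move: near_p; rewrite invfM ler_pdivlMr// mulrC.
by exists n; rewrite -pn; have := @pickle_invK rat i; rewrite ip /= => ->.
Qed.

(* At [x], only the bumps centred at convergents of [x] contribute. *)
Let off_convergents i : (forall n, i != e n) ->
  rat_weight R k i = 0 \/ rat_radius R i < `|x - rat_center R i|.
Proof.
move=> ne; rewrite /rat_weight /rat_radius /rat_center.
case ip: (pickle_inv i) => [p|]; [right|by left].
rewrite ltNge; apply/negP => /(near_rat_convergent ip)[n ien].
by have := ne n; rewrite ien eqxx.
Qed.

Lemma rat_bumps_overlap :
  (\sum_(0 <= i <oo) (rat_weight R k i *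
     \1_(bump_itv (rat_center R i) (rat_radius R i)) x)%:E <= 8%:E)%E.
Proof.
rewrite (nneseries_reindex _ e_inj); last 2 first.
- by move=> i; rewrite lee_fin mulr_ge0// rat_weight_ge0.
- move=> i /off_convergents[->|]; first by rewrite mul0r.
  by rewrite indicE bump_itvE ltNge => /negbTE ->; rewrite mulr0.
apply: nneseries_le => [n|n].
  by rewrite lee_fin mulr_ge0// rat_weight_ge0.
rewrite sumEFin lee_fin; apply: (@le_trans _ _ (\sum_(i < n) 2 * beta i)).
  apply: ler_sum => i _; apply: le_trans (weight_le i).
  by rewrite -weightE ler_piMr ?rat_weight_ge0// indicE lern1 leq_b1.
by rewrite -mulr_sumr; have := sum_cfbeta_le alpha_range x_irr n; lra.
Qed.

Let L n := ln `|y n|^-1.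
Let L' n := lnp (rat_radius R (e n) / `|x - rat_center R (e n)|).

Let L'E n : L' n = lnp (`|y n|^-1 / (8 * (q n * beta n))).
Proof.
have q1 := conv_den_ge1 alpha_range x_irr n.
have b0 := cfbeta_gt0 alpha_range x_irr n.
have y0 : `|y n| != 0 by rewrite normr_eq0 cfrem_neq0.
have := convergent_err alpha_range x_irr n; rewrite cfbetaS => err.
rewrite /L' /rat_radius /rat_center pickleK_inv (convergentE alpha_range x_irr n).2.
have -> : `|x - ratr (convergent alpha x n)| = beta n * `|y n| / q n.
  by rewrite -err mulrC mulKf//; rewrite gt_eqF//; lra.
congr lnp; field; rewrite y0 !gt_eqF//; lra.
Qed.

Let log_close n : `|L n - L' n| <= 4 /\ 0 <= L n /\ `|y n| * L n <= 1.
Proof.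
have [tge tle _] := conv_den_beta alpha_range x_irr n.
have /andP[y0 y1] := cfrem_norm alpha_range x_irr n.
have yV : 1 < `|y n|^-1 by rewrite invf_gt1.
have L0 : 0 <= L n by rewrite ln_ge0// ltW.
rewrite L'E; move: tge tle; set t := q n * beta n => tge tle.
have lnE : ln (`|y n|^-1 / (8 * t)) = L n - ln (8 * t).
  by rewrite ln_div ?posrE ?invr_gt0//; lra.
(* As t lies in [1/2, 2], 8 t lies between 1 and 16 = 2^4. *)
have t4 : ln (8 * t) <= 4 by apply: (@ln_le_nat _ _ 4); lra.
have t0 : 0 <= ln (8 * t) by rewrite ln_ge0//; lra.
split; last split => //.
  rewrite /lnp lnE ler_norml.
  by case: (leP 0 (L n - ln (8 * t))) => h; apply/andP; split; lra.
(* log z <= z - 1 at z = 1/x_n *)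
have : L n <= `|y n|^-1 - 1.
  rewrite /L -{1}[`|y n|^-1](addrNK 1) addrC; apply: le_ln1Dx; lra.
rewrite -(ler_pM2l y0) mulrBr divff ?gt_eqF// mulr1 => h.
by apply: le_trans h _; lra.
Qed.

(** The sum bounds |t^k - 1| / |t - 1| for t in [0, 2]. *)
Definition comparison_const : R := 4 * \sum_(i < k) 2 ^+ i + 8.

(** With t = q_n beta_{n-1} and L = log(1/x_n), the difference of the two terms
    is q_n^{-k} ((t^k - 1) L + O(1)); since |t - 1| <= 2 x_n, the factor x_n
    absorbs the logarithm L. *)
Lemma brjuno_term_close n :
  `|beta n ^+ k * L n - q n ^- k * L' n| <= comparison_const * beta n.
Proof.
have q1 := conv_den_ge1 alpha_range x_irr n.
have [tge tle tclose] := conv_den_beta alpha_range x_irr n.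
have [LL' [L0 yL]] := log_close n.
move: tge tle tclose; set t := q n * beta n => tge tle tclose.
have W0 : 0 <= q n ^- k by rewrite invr_ge0 exprn_ge0//; lra.
have bE : beta n ^+ k = q n ^- k * t ^+ k.
  by rewrite /t exprMn mulKf// expf_neq0// gt_eqF//; lra.
pose D : R := \sum_(i < k) 2 ^+ i.
have D0 : 0 <= D by apply: sumr_ge0 => i _; rewrite exprn_ge0.
have tk : `|t ^+ k - 1| <= D * `|t - 1|.
  rewrite subrX1 normrM mulrC ler_wpM2r//.
  rewrite ger0_norm; last by apply: sumr_ge0 => i _; rewrite exprn_ge0//; lra.
  by apply: ler_sum => i _; rewrite lerXn2r ?nnegrE//; lra.
have -> : beta n ^+ k * L n - q n ^- k * L' n =
    q n ^- k * ((t ^+ k - 1) * L n + (L n - L' n)) by rewrite bE; ring.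
rewrite normrM (ger0_norm W0).
apply: (@le_trans _ _ (q n ^- k * (2 * D + 4))).
  rewrite ler_wpM2l// (le_trans (ler_normD _ _))// lerD//.
  rewrite normrM (ger0_norm L0).
  apply: (@le_trans _ _ (D * (2 * `|y n|) * L n)).
    by rewrite ler_wpM2r// (le_trans tk)// ler_wpM2l.
  have -> : D * (2 * `|y n|) * L n = 2 * D * (`|y n| * L n) by ring.
  by rewrite ler_piMr// mulr_ge0.
have -> : comparison_const * beta n = 2 * beta n * (2 * D + 4).
  by rewrite /comparison_const -/D; ring.
by rewrite ler_wpM2r ?weight_le//; lra.
Qed.

Let comparison_const_ge0 : 0 <= comparison_const.
Proof. by rewrite addr_ge0// mulr_ge0// sumr_ge0// => i _; rewrite exprn_ge0. Qed.

Let brjunoE : brjuno_series k alpha `|centered_rem alpha x| =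
  (\sum_(0 <= n <oo) (beta n ^+ k * L n)%:E)%E.
Proof. by apply: eq_eseriesr => n _; rewrite iter_cfmap. Qed.

Let rat_log_bumpsE : rat_log_bumps k x =
  (\sum_(0 <= n <oo) (q n ^- k * L' n)%:E)%E.
Proof.
rewrite /rat_log_bumps /log_bump_series (nneseries_reindex _ e_inj).
- by apply: eq_eseriesr => n _; rewrite /log_bump weightE.
- by move=> i; rewrite lee_fin mulr_ge0 ?lnp_ge0 ?rat_weight_ge0.
- move=> i /off_convergents[wi|si]; rewrite /log_bump; first by rewrite wi mul0r.
  have /andP[s0 _] := rat_radius01 R i.
  rewrite /lnp max_l ?mulr0// ln_le0// ler_pdivrMr ?mul1r; first exact: ltW.
  exact: lt_trans si.
Qed.

Let sum_close (u v : nat -> R) : (forall n, 0 <= u n) -> (forall n, 0 <= v n) ->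
  (forall n, u n <= v n + comparison_const * beta n) ->
  (\sum_(0 <= n <oo) (u n)%:E <=
   \sum_(0 <= n <oo) (v n)%:E + (4 * comparison_const)%:E)%E.
Proof.
move=> u0 v0 uv.
apply: (@le_trans _ _
    (\sum_(0 <= n <oo) ((v n)%:E + (comparison_const * beta n)%:E))%E).
  by apply: lee_nneseries => [n _ _|n _]; rewrite -?EFinD lee_fin.
have cb n : 0 <= comparison_const * beta n.
  by rewrite mulr_ge0// ltW// cfbeta_gt0.
rewrite nneseriesD; try by move=> *; rewrite lee_fin.
rewrite leeD2l//; apply: nneseries_le => [n|n]; first by rewrite lee_fin.
rewrite sumEFin lee_fin -mulr_sumr mulrC ler_wpM2r//.
exact: sum_cfbeta_le.
Qed.

Lemma brjuno_near_rat_log_bumps :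
  (brjuno_series k alpha `|centered_rem alpha x| <=
     rat_log_bumps k x + (4 * comparison_const)%:E)%E /\
  (rat_log_bumps k x <=
     brjuno_series k alpha `|centered_rem alpha x| + (4 * comparison_const)%:E)%E.
Proof.
have b0 n : 0 <= beta n ^+ k * L n.
  rewrite mulr_ge0//; last by have [_ []] := log_close n.
  by rewrite exprn_ge0// ltW// cfbeta_gt0.
have g0 n : 0 <= q n ^- k * L' n.
  by rewrite -weightE mulr_ge0 ?rat_weight_ge0 ?lnp_ge0.
rewrite brjunoE rat_log_bumpsE; split; apply: sum_close => // n;
  by have := brjuno_term_close n; rewrite ler_norml => /andP[]; lra.
Qed.

End comparison.

(** * The Brjuno function almost everywhere *)

Section folded_brjuno.
Variables (R : realType) (k : nat) (alpha : R).
Local Notation mu := (@lebesgue_measure R).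
Hypothesis alpha_range : 2^-1 <= alpha <= 1.

(** The argument is folded to its distance from the integer m such that x - m lies
    in [alpha - 1, alpha).  This is a Borel measurable representative of the
    k-Brjuno function. *)
Definition folded_brjuno (x : R) : \bar R :=
  brjuno_series k alpha `|centered_rem alpha x|.

Lemma measurable_centered_rem : measurable_fun setT (centered_rem alpha).
Proof.
apply: measurable_funB => //.
apply: (measurableT_comp (f := fun z : R => (Num.floor z)%:~R : R)).
  apply: nondecreasing_measurable => // a b ab.
  by rewrite ler_int; apply: le_floor.
by apply: measurable_funD => //; exact: measurable_funB.
Qed.

Lemma measurable_cfmap : measurable_fun setT (cfmap alpha).
Proof.
apply: measurableT_comp => //.
exact: (measurableT_comp measurable_centered_rem (@measurable_invr R)).
Qed.

Lemma measurable_iter_cfmap n : measurable_fun setT (iter n (cfmap alpha)).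
Proof.
elim: n => [|n IHn]; first exact: measurable_id.
exact: (measurableT_comp measurable_cfmap IHn).
Qed.

Lemma measurable_cfbeta n : measurable_fun setT (cfbeta alpha n).
Proof.
elim: n => [|n IHn].
  rewrite (_ : cfbeta alpha 0 = cst 1)//.
  by apply/funext => x; rewrite /cfbeta big_ord0.
rewrite (_ : cfbeta alpha n.+1 = cfbeta alpha n \* iter n (cfmap alpha)).
  by apply: measurable_funM => //; exact: measurable_iter_cfmap.
by apply/funext => x; rewrite /cfbeta big_ord_recr.
Qed.

Lemma folded_term_ge0 n x :
  0 <= cfbeta alpha n `|centered_rem alpha x| ^+ k *
       ln (iter n (cfmap alpha) `|centered_rem alpha x|)^-1.
Proof.
have b0 m : 0 <= cfbeta alpha m `|centered_rem alpha x|.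
  by apply: prodr_ge0 => i _; rewrite iter_cfmap.
rewrite mulr_ge0 ?exprn_ge0// iter_cfmap.
have [->|y0] := eqVneq (cfrem alpha x n) 0; first by rewrite normr0 invr0 ln0.
rewrite ln_ge0// invf_ge1 ?normr_gt0// ler_norml.
by move: alpha_range (cfrem_itv alpha x n) => /andP[? ?] /andP[? ?]; lra.
Qed.

Lemma folded_brjuno_ge0 x : (0 <= folded_brjuno x)%E.
Proof. by apply: nneseries_ge0 => n _ _; rewrite lee_fin folded_term_ge0. Qed.

Lemma measurable_folded_brjuno : measurable_fun setT folded_brjuno.
Proof.
apply: measurable_nneseries => [n x|n]; first by rewrite lee_fin folded_term_ge0.
have mfold : measurable_fun setT (fun x : R => `|centered_rem alpha x|).
  by apply: measurableT_comp => //; exact: measurable_centered_rem.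
apply/measurable_EFinP; apply: measurable_funM.
  apply: measurable_funX.
  exact: (measurableT_comp (@measurable_cfbeta n) mfold).
apply: (measurableT_comp (@measurable_ln R)).
apply: (measurableT_comp (@measurable_invr R)).
exact: (measurableT_comp (@measurable_iter_cfmap n) mfold).
Qed.

Lemma irrational_centered_rem x : irrational x -> irrational (centered_rem alpha x).
Proof.
move=> x_irr [p _ px]; apply: x_irr; exists (p + (Num.floor (x - alpha + 1))%:~R) => //.
by rewrite rmorphD/= ratr_int px /centered_rem subrK.
Qed.

Lemma irrationalN (x : R) : irrational x -> irrational (- x).
Proof.
by move=> x_irr [p _ px]; apply: x_irr; exists (- p) => //; rewrite rmorphN/= px opprK.
Qed.

Lemma irrational_neq0 (x : R) : irrational x -> x != 0.
Proof.
by move=> x_irr; apply/eqP => x0; apply: x_irr; exists 0 => //; rewrite x0 rmorph0.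
Qed.

(** The points of alpha - 1 + Z are discarded along with the rationals, because
    evenness is only assumed on the open interval from 0 to 1 - alpha. *)
Lemma is_brjuno_folded (B : R -> \bar R) : is_brjuno k alpha B ->
  {ae mu, forall x, B x = folded_brjuno x}.
Proof.
move=> [B_series B_periodic B_even]; have /andP[a2 a1] := alpha_range.
have periodic := ae_forall_int B_periodic.
have even : {ae mu, forall x, forall m : int,
    0 < m%:~R - x < 1 - alpha -> B (- (m%:~R - x)) = B (m%:~R - x)}.
  by apply: ae_forall_int => m; exact: (ae_reflect m%:~R B_even).
have offgrid : {ae mu, forall x, forall m : int, x <> alpha - 1 + m%:~R}.
  apply: ae_forall_int => m.
  have := @countable_ae R [set alpha - 1 + m%:~R] (countable1 _).
  by apply: filterS => x.
have generic : {ae mu, forall x,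
    irrational x /\ forall m : int, x <> alpha - 1 + m%:~R}.
  by apply: filterS2 (irrational_ae R) offgrid => x.
apply: filterS3 generic periodic even => x [x_irr x_off] x_per x_even.
pose m := Num.floor (x - alpha + 1).
have yE : centered_rem alpha x = x - m%:~R by [].
have y_irr := irrational_centered_rem x_irr.
have /andP[y1 y2] := centered_rem_itv alpha x.
rewrite /folded_brjuno; move: yE y_irr y1 y2.
move: (centered_rem alpha x) => y yE y_irr y1 y2.
have -> : B x = B y by rewrite -(x_per (- m)) rmorphN yE.
case: (ger0P y) => y0.
  by apply: B_series => //; rewrite y2 andbT lt0r y0 andbT irrational_neq0.
have yoff : alpha - 1 < y.
  rewrite lt_neqAle y1 andbT; apply/eqP => ya; apply: (x_off m).
  by rewrite ya yE subrK.
have yN : m%:~R - x = - y by rewrite yE opprB.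
have := x_even m; rewrite yN opprK => ->; last by apply/andP; split; lra.
by apply: B_series; [exact: irrationalN|apply/andP; split; lra].
Qed.

End folded_brjuno.

(** * Membership in BMO *)

Theorem proposition2p1 (R : realType) (k : nat) (alpha : R)
    (k_ge1 : (1 <= k)%N) (alpha_range : 2^-1 <= alpha <= 1)
    (B : R -> \bar R) (B_brjuno : is_brjuno k alpha B) :
  BMO [set: R] B.
Proof.
pose w := rat_weight R k; pose r := rat_center R; pose s := rat_radius R.
have w0 := rat_weight_ge0 R k; have s01 := rat_radius01 R.
have eight0 : 0 <= 8 :> R by [].
have C0 : 0 <= 4 * comparison_const R k.
  by rewrite mulr_ge0// addr_ge0// mulr_ge0// sumr_ge0// => i _; rewrite exprn_ge0.
have overlap : {ae @lebesgue_measure R, forall x,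
    (\sum_(0 <= i <oo) (w i * \1_(bump_itv (r i) (s i)) x)%:E <= 8%:E)%E}.
  apply: filterS (irrational_ae R) => x x_irr.
  exact: rat_bumps_overlap k_ge1 alpha_range x_irr.
have near : {ae @lebesgue_measure R, forall x,
    (folded_brjuno k alpha x <=
       log_bump_series w r s x + (4 * comparison_const R k)%:E)%E /\
    (log_bump_series w r s x <=
       folded_brjuno k alpha x + (4 * comparison_const R k)%:E)%E}.
  apply: filterS (irrational_ae R) => x x_irr.
  exact: brjuno_near_rat_log_bumps k_ge1 alpha_range x_irr.
have F0 := folded_brjuno_ge0 k alpha_range.
have mF := measurable_folded_brjuno k alpha_range.
exists (fine \o folded_brjuno k alpha); split.
  have finF := near_log_bump_fin w0 s01 eight0 overlap F0 near.
  apply: filterS2 (is_brjuno_folded alpha_range B_brjuno) finF => x -> Ffin _.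
  by rewrite /= fineK.
exact: (near_log_bump_BMO w0 s01 eight0 overlap F0 mF C0 near).
Qed.
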